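(* Let $0\le t_1<t_2<+\infty$ and $z\in\mathbb C^{\rm up}$, with $\arg z\in(0,\pi)$. (1) If $\frac\pi2\le\arg z<\pi$, i.e. $\cos\arg z\le0$, then $$\omega(z,[t_1,t_2])\le(t_2-t_1)\,\frac1\pi\operatorname{Im}\frac1{\bar z}.$$ (2) If $-1<\cos\arg z<\frac{2\sqrt{t_1t_2}}{t_1+t_2}$, then $$\omega(z,[t_1,t_2])\le\frac{(t_2-t_1)\operatorname{Im}z}{\pi\bigl(|z|-\sqrt{t_1t_2}\bigr)^2},$$ the right-hand side being understood as $+\infty$ when $|z|=\sqrt{t_1t_2}$. (3) If for some $a\in(0,1)$ one has $-1<\cos\arg z\le\frac{2a\sqrt{t_1t_2}}{t_1+t_2}$, then $$\omega(z,[t_1,t_2])\le\frac{t_2-t_1}{\pi(1-a^2)}\operatorname{Im}\frac1{\bar z}.$$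
   Context: $\mathbb C^{\rm up}=\{\operatorname{Im}z>0\}$. Harmonic measure of the upper half-plane: $\omega(z,B)=\frac1\pi\int_{B\cap\mathbb R}\frac{\operatorname{Im}z}{(t-\operatorname{Re}z)^2+(\operatorname{Im}z)^2}\,dt$ for $z\in\mathbb C^{\rm up}$ and Borel $B$. *)

(* Defs.v *)
(* Written in MathComp-Analysis, with the complex numbers R[i] of
   mathcomp-real-closed over an arbitrary R : realType. *)
From HB Require Import structures.
From mathcomp Require Export all_boot all_order all_algebra.
From mathcomp Require Export all_classical all_reals all_analysis.
From mathcomp Require Export complex.

Set Implicit Arguments.
Unset Strict Implicit.
Unset Printing Implicit Defensive.

Export Order.TTheory GRing.Theory Num.Theory.
Export numFieldNormedType.Exports.

Local Open Scope classical_set_scope.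
Local Open Scope ring_scope.
Local Open Scope complex_scope.

(* The norm `|z| of R[i] is itself in R[i]; the modulus as an element of R is
   its real part. *)
Definition modulus (R : realType) (z : R[i]) : R := complex.Re `|z|.

Definition upper_half_plane (R : realType) : set R[i] := [set z | 0 < complex.Im z].
Arguments upper_half_plane {R}.

Definition is_principal_arg (R : realType) (z : R[i]) (theta : R) : Prop :=
  - pi < theta <= pi /\
  z = (modulus z)%:C * (cos theta +i* sin theta).

(* Every z != 0 has exactly one principal argument (at z = 0 the value is
   junk); see argP for the upper half-plane. *)
Definition arg (R : realType) (z : R[i]) : R := xget 0 (is_principal_arg z).

Definition harmonic_measure (R : realType) (z : R[i]) (B : set R[i]) : \bar R :=
  ((pi^-1)%:E *
   \int[lebesgue_measure]_(t in [set t : R | B t%:C])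
     (complex.Im z / ((t - complex.Re z) ^+ 2 + complex.Im z ^+ 2))%:E)%E.

Definition real_segment (R : realType) (t1 t2 : R) : set R[i] :=
  [set t%:C | t in `[t1, t2]].

Lemma modulusE (R : realType) (z : R[i]) :
  modulus z = Num.sqrt (complex.Re z ^+ 2 + complex.Im z ^+ 2).
Proof. by case: z. Qed.

Lemma argP (R : realType) (z : R[i]) : upper_half_plane z ->
  0 < arg z < pi /\ z = (modulus z)%:C * (cos (arg z) +i* sin (arg z)).
Proof.
case: z => x y; rewrite /upper_half_plane /= => y0.
set z := x +i* y; set r := modulus z.
have r2 : r ^+ 2 = x ^+ 2 + y ^+ 2.
  by rewrite /r modulusE /= sqr_sqrtr // addr_ge0 // sqr_ge0.
have r0 : 0 < r by rewrite /r modulusE sqrtr_gt0 ltr_wpDl ?sqr_ge0 ?exprn_gt0.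
have xr : -1 <= x / r <= 1.
  rewrite -ler_norml normf_div (gtr0_norm r0) ler_pdivrMr // mul1r.
  rewrite -(@ler_pXn2r _ 2) ?nnegrE ?normr_ge0 ?(ltW r0) //.
  by rewrite real_normK ?num_real // r2 lerDl sqr_ge0.
have sE : 1 - (x / r) ^+ 2 = (y / r) ^+ 2.
  have rn : r ^+ 2 != 0 by rewrite expf_neq0 // gt_eqF.
  by rewrite !expr_div_n -{1}(divff rn) -mulrBl r2 [X in X - _]addrC addrK.
have H : is_principal_arg z (acos (x / r)).
  split.
    rewrite acos_lepi // andbT (lt_le_trans _ (acos_ge0 xr)) //.
    by rewrite oppr_lt0 pi_gt0.
  rewrite acosK ?in_itv // sin_acos // sE sqrtr_sqr ger0_norm; last first.
    by rewrite divr_ge0 // ltW.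
  rewrite -/r; apply/eqP; rewrite eq_complex /= !mul0r subr0 addr0.
  have rn : r != 0 by rewrite gt_eqF.
  by rewrite ![r * _]mulrC !divfK // !eqxx.
have [/andP[h1 h2] h3] := xgetPex 0 (ex_intro (is_principal_arg z) _ H).
split => //.
have s0 : 0 < sin (arg z).
  have := congr1 (@complex.Im R) h3; rewrite -/(arg z) -/r /= mul0r addr0 => yE.
  by move: y0; rewrite yE pmulr_rgt0.
rewrite -/(arg z) in h1 h2.
apply/andP; split.
  rewrite ltNge; apply/negP => a0.
  have : 0 <= sin (- arg z).
    by apply: sin_ge0_pi; rewrite oppr_ge0 a0 lerNl ltW.
  by rewrite sinN oppr_ge0 leNgt s0.
rewrite lt_neqAle h2 andbT; apply/eqP => E.
by move: s0; rewrite E sinpi ltxx.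
Qed.

Lemma cos_arg_le0 (R : realType) (z : R[i]) : upper_half_plane z ->
  (pi / 2 <= arg z < pi) = (cos (arg z) <= 0).
Proof.
move=> /argP[/andP[a0 api] _]; rewrite api andbT -(@cos_pihalf R).
have p0 := pi_gt0 R.
rewrite [RHS]leNgt ltr_cos ?in_itv /= -?leNgt //; apply/andP; split.
- exact: ltW.
- exact: ltW.
- by rewrite divr_ge0 ?pi_ge0.
- by rewrite ler_pdivrMr // ler_peMr ?pi_ge0 // ler1n.
Qed.

(* Main.v *)
(* Write z = x + iy and D t = (t1 - x) (t - x) + y ^ 2, an affine function of t
   with D t1 = (t1 - x) ^ 2 + y ^ 2. By Cauchy-Schwarz the Poisson kernel
   y / ((t - x) ^ 2 + y ^ 2) is at most y * D t1 / D t ^ 2, the derivative of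
   y * (t - t1) / D t, so that omega (z, [t1, t2]) <= (t2 - t1) y / (pi * D t2)
   whenever D t2 > 0. Moreover D t2 = t1 * t2 - (t1 + t2) |z| cos (arg z) + |z|^2,
   and each of the three hypotheses on arg z bounds this quantity from below by
   the denominator in the corresponding conclusion. *)
Require Import Defs.
From mathcomp Require Import measurable_realfun ring lra.

Local Open Scope classical_set_scope.
Local Open Scope ring_scope.
Local Open Scope complex_scope.

(** By the quotient rule, the terms in [t - a] cancel in [y * (p + k * (t - a)) - y * (t - a) * k],
    leaving the constant [y * p]. *)
Lemma is_derive_affine_ratio (R : realType) (y a p k t : R) :
  p + k * (t - a) != 0 ->
  is_derive t 1 (fun s => y * (s - a) / (p + k * (s - a)))
    (y * p / (p + k * (t - a)) ^+ 2).
Proof.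
move=> d0.
have dB : is_derive t (1 : R) (fun s : R => s - a) 1.
  by apply: (is_derive_eq (is_deriveB _ _)); rewrite subr0.
have dn : is_derive t (1 : R) (fun s : R => y * (s - a)) y.
  by apply: (is_derive_eq (is_deriveZ y dB)); rewrite /GRing.scale /= mulr1.
have dd : is_derive t (1 : R) (fun s : R => p + k * (s - a)) k.
  apply: (is_derive_eq (is_deriveD (is_derive_cst p t 1) (is_deriveZ k dB))).
  by rewrite add0r /GRing.scale /= mulr1.
have dV := @is_deriveV R _ t k 1 d0 dd.
apply: (is_derive_eq (is_deriveM dn dV)); rewrite /GRing.scale /=.
by field.
Qed.

Lemma integral_affine_ratio (R : realType) (y p k a b : R) : a < b ->
  (forall t, t \in `[a, b] -> 0 < p + k * (t - a)) ->
  (\int[lebesgue_measure]_(t in `[a, b])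
     (y * p / (p + k * (t - a)) ^+ 2)%:E =
   (y * (b - a) / (p + k * (b - a)))%:E)%E.
Proof.
move=> ab d0.
pose F s := y * (s - a) / (p + k * (s - a)).
have dF t : t \in `[a, b] -> is_derive t 1 F (y * p / (p + k * (t - a)) ^+ 2).
  by move=> /d0/lt0r_neq0; exact: is_derive_affine_ratio.
have cF t : t \in `[a, b] -> {for t, continuous F}.
  by move=> /dF[dFt _]; exact/differentiable_continuous/derivable1_diffP.
rewrite (@continuous_FTC2 _ _ F) //.
- by rewrite /F subrr mulr0 mul0r sube0.
- apply: derivable_within_continuous => t /d0/lt0r_neq0 dt.
  have : (p + k * (t - a)) ^+ 2 != 0 by rewrite expf_neq0.
  move=> dt2; apply: derivableM => //; exact: derivableV.
- split=> [t /subset_itv_oo_cc /dF[]//||].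
  + by apply: cvg_at_right_filter; apply: cF; rewrite in_itv /= lexx ltW.
  + by apply: cvg_at_left_filter; apply: cF; rewrite in_itv /= lexx ltW.
- by move=> t /subset_itv_oo_cc /dF[_]; rewrite derive1E.
Qed.

Lemma poisson_kernel_le (R : realFieldType) (u v y : R) : 0 < y ->
  0 < u * v + y ^+ 2 ->
  y / (v ^+ 2 + y ^+ 2) <= y * (u ^+ 2 + y ^+ 2) / (u * v + y ^+ 2) ^+ 2.
Proof.
move=> y0 d0; have y2 : 0 < y ^+ 2 by rewrite exprn_gt0.
rewrite -mulrA ler_pM2l // ler_pdivlMr ?exprn_gt0 // ler_pdivrMl; last first.
  by rewrite ltr_wpDl // sqr_ge0.
(* Lagrange's identity for the vectors [(u, y)] and [(v, y)]: the defect in Cauchy-Schwarz is the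
   square of their determinant. *)
rewrite -subr_ge0 (_ : _ - _ = (y * (u - v)) ^+ 2) ?sqr_ge0 //; ring.
Qed.

Lemma preimage_real_segment (R : realType) (a b : R) :
  [set t : R | real_segment a b t%:C] = `[a, b]%classic.
Proof.
by apply/seteqP; split=> [t [s sab [<-]]|t tab] //; exists t.
Qed.

Lemma measurable_poisson_kernel (R : realType) (x y : R) (D : set R) : y != 0 ->
  measurable_fun D (fun t => y / ((t - x) ^+ 2 + y ^+ 2)).
Proof.
move=> y0; apply: measurable_funTS; apply: continuous_measurable_fun => t.
apply/differentiable_continuous/derivable1_diffP.
have : (t - x) ^+ 2 + y ^+ 2 != 0.
  by rewrite gt_eqF // ltr_wpDl ?sqr_ge0 // exprn_even_gt0.
by move=> d0; apply: derivableM => //; exact: derivableV.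
Qed.

(** Common core of the three estimates: each one amounts to a choice of a positive lower bound [d]
    for D t2. *)
Lemma harmonic_measure_le (R : realType) (t1 t2 d : R) (z : R[i]) :
  t1 < t2 -> 0 < complex.Im z -> 0 < d ->
  d <= (t1 - complex.Re z) * (t2 - complex.Re z) + complex.Im z ^+ 2 ->
  (harmonic_measure z (real_segment t1 t2) <=
     ((t2 - t1) * complex.Im z / (pi * d))%:E)%E.
Proof.
case: z => x y /= t12 y0 d0 dle; rewrite /harmonic_measure preimage_real_segment.
set p := (t1 - x) ^+ 2 + y ^+ 2; set k := t1 - x.
have Dp t : p + k * (t - t1) = k * (t - x) + y ^+ 2 by rewrite /p /k; ring.
have D0 t : t \in `[t1, t2] -> 0 < p + k * (t - t1).
  have p0 : 0 < p by rewrite ltr_wpDl ?sqr_ge0 ?exprn_gt0.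
  have D2 : 0 < p + k * (t2 - t1) by rewrite Dp (lt_le_trans d0).
  rewrite in_itv /= => /andP[t1t tt2].
  (* An affine function is at least the smaller of its endpoint values: [p] at [t1] if [k] is
     nonnegative, D t2 at [t2] if [k] is negative. *)
  case: (lerP 0 k) => [k0|k0].
    by apply: ltr_wpDr => //; apply: mulr_ge0 => //; rewrite subr_ge0.
  by apply: (lt_le_trans D2); rewrite lerD2l ler_wnM2l ?lerD2r // ltW.
rewrite (_ : _ / _ = pi^-1 * ((t2 - t1) * y / d)); last by rewrite invfM; ring.
rewrite EFinM lee_wpmul2l ?lee_fin ?invr_ge0 ?pi_ge0 //.
(* The intermediate value is the exact integral of the majorant; its denominator is D t2, which is
   then bounded below by [d]. *)
apply: (@le_trans _ _ (y * (t2 - t1) / (p + k * (t2 - t1)))%:E).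
  rewrite -integral_affine_ratio //; apply: ge0_le_integral => //=.
  - move=> t _; rewrite lee_fin divr_ge0 ?addr_ge0 ?sqr_ge0 //; exact: ltW.
  - by apply/measurable_EFinP; apply: measurable_poisson_kernel; rewrite gt_eqF.
  - apply/measurable_EFinP; apply: subspace_continuous_measurable_fun => //.
    apply: derivable_within_continuous => t /D0/lt0r_neq0 dt.
    have : (p + k * (t - t1)) ^+ 2 != 0 by rewrite expf_neq0.
    by move=> dt2; apply: derivableM => //; exact: derivableV.
  - move=> t tI; have := D0 t tI; rewrite lee_fin Dp => ?.
    exact: poisson_kernel_le.
rewrite lee_fin [y * _]mulrC ler_pM2l ?mulr_gt0 ?subr_gt0 //.
by rewrite lef_pV2 ?posrE ?Dp // (lt_le_trans d0).
Qed.

(** This is the imaginary part of [1 / z^* = z / |z|^2]. *)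
Lemma Im_inv_conj (R : realType) (z : R[i]) :
  complex.Im (1 / z^*) = complex.Im z / modulus z ^+ 2.
Proof.
rewrite modulusE sqr_sqrtr ?addr_ge0 ?sqr_ge0 // mul1r.
by case: z => x y /=; rewrite sqrrN mulNr opprK.
Qed.

Theorem mainTheorem12 (R : realType) (t1 t2 : R) (z : R[i])
    (t1_ge0 : 0 <= t1) (t1_lt_t2 : t1 < t2) (zup : upper_half_plane z) :
  [/\ pi / 2 <= arg z < pi ->
      (harmonic_measure z (real_segment t1 t2) <=
        ((t2 - t1) * (1 / pi) * complex.Im (1 / z^*))%:E)%E,
      -1 < cos (arg z) < 2 * Num.sqrt (t1 * t2) / (t1 + t2) ->
      (harmonic_measure z (real_segment t1 t2) <=
        if modulus z == Num.sqrt (t1 * t2) then +oo else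
        ((t2 - t1) * complex.Im z /
          (pi * (modulus z - Num.sqrt (t1 * t2)) ^+ 2))%:E)%E
    & forall a : R, 0 < a < 1 ->
      -1 < cos (arg z) <= 2 * a * Num.sqrt (t1 * t2) / (t1 + t2) ->
      (harmonic_measure z (real_segment t1 t2) <=
        ((t2 - t1) / (pi * (1 - a ^+ 2)) * complex.Im (1 / z^*))%:E)%E].
Proof.
have [_ zE] := argP zup; rewrite cos_arg_le0 // Im_inv_conj.
have y0 : 0 < complex.Im z by [].
set c := cos (arg z) in zE *; set r := modulus z in zE *; set q := Num.sqrt _.
have r2 : r ^+ 2 = complex.Re z ^+ 2 + complex.Im z ^+ 2.
  by rewrite /r modulusE sqr_sqrtr // addr_ge0 // sqr_ge0.
have r0 : 0 < r by rewrite /r modulusE sqrtr_gt0 ltr_wpDl ?sqr_ge0 ?exprn_gt0.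
have xE : complex.Re z = r * c by rewrite zE /= mul0r subr0.
have q2 : q ^+ 2 = t1 * t2.
  by rewrite sqr_sqrtr // mulr_ge0 // ltW // (le_lt_trans t1_ge0).
have s0 : 0 < t1 + t2 by lra.
have DE : (t1 - complex.Re z) * (t2 - complex.Re z) + complex.Im z ^+ 2 =
    q ^+ 2 + r ^+ 2 - r * (c * (t1 + t2)).
  by rewrite q2 r2 !xE; ring.
have r20 : 0 < r ^+ 2 by rewrite exprn_gt0.
have q20 : 0 <= q ^+ 2 by exact: sqr_ge0.
split.
(* Take [d = r ^+ 2]: the cross term of [DE] only increases D t2 when [c <= 0]. *)
- move=> c0; rewrite (_ : _ * _ = (t2 - t1) * complex.Im z / (pi * r ^+ 2)).
    apply: harmonic_measure_le => //; rewrite DE.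
    have : r * (c * (t1 + t2)) <= 0 by rewrite pmulr_rle0 // pmulr_lle0.
    lra.
  by rewrite [(pi * _)^-1]invfM; ring.
- rewrite ltr_pdivlMr // => /andP[_ cq].
  (* Away from [r = q], the choice [d = (r - q) ^+ 2] is positive, and [c * (t1 + t2) < 2 * q] makes
     it a lower bound. *)
  case: eqVneq => [_|rq]; first exact: leey.
  apply: harmonic_measure_le => //; rewrite ?DE.
    by rewrite exprn_even_gt0 //= subr_eq0.
  have := ltW cq; rewrite -(ler_pM2l r0) sqrrB -[_ *+ 2]mulr_natl; lra.
- move=> a /andP[a0 a1]; rewrite ler_pdivlMr // => /andP[_ cq].
  have a21 : 0 < 1 - a ^+ 2 by rewrite subr_gt0 expr_lt1 // ltW.
  rewrite (_ : _ * _ =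
      (t2 - t1) * complex.Im z / (pi * ((1 - a ^+ 2) * r ^+ 2))).
    apply: harmonic_measure_le => //; rewrite ?DE ?mulr_gt0 //.
    move: cq; rewrite -(ler_pM2l r0) => cq.
    (* Completing the square: [q^2 + r^2 - 2 a q r = (q - a r)^2 + (1 - a^2) r^2]. *)
    have := sqr_ge0 (q - a * r); lra.
  by rewrite ![(pi * _)^-1]invfM [(_ * r ^+ 2)^-1]invfM; ring.
Qed.
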